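(* Let $K$ be a kernel such that $K(t,\cdot)\in L_2([0,t])$ for every $t\in[0,1]$ and $\sup_{t\in[0,1]}\int_0^t K(t,s)^2\,ds<\infty$. Then the functional $f(x)=\sup_{t\in[0,1]}\left(\int_0^t (K(t,s)-x(s))^2\,ds\right)^{1/2}$ is continuous on $L_2([0,1])$.
   Context: $K=K(t,s)$ is a real-valued kernel, $t,s\in[0,1]$, arbitrary apart from the stated condition. $L_2([0,1])$ is the real Hilbert space of square integrable functions on $[0,1]$ with respect to Lebesgue measure, with its norm topology. *)

(* Defs.v *)
From HB Require Import structures.
From mathcomp Require Import all_boot all_order all_algebra.
From mathcomp Require Import all_classical all_reals all_analysis.
From mathcomp Require Import measurable_realfun ess_sup_inf.

Set Implicit Arguments.
Unset Strict Implicit.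
Unset Printing Implicit Defensive.
Import Order.TTheory GRing.Theory Num.Theory.
Import numFieldNormedType.Exports.

Local Open Scope classical_set_scope.
Local Open Scope quotient_scope.
Local Open Scope ring_scope.

(* The library's [LspaceType mu p1] (classes of p-integrable functions modulo
   equality mu-almost everywhere) carries no algebraic or topological structure.
   It is made here into a normed module over R, whose topology is thus the norm
   topology, with pointwise operations on representatives and norm ['N[mu]_p]. *)
Section Lspace_normedModType.
Context d (T : measurableType d) (R : realType).
Variables (mu : {measure set T -> \bar R}) (p : \bar R) (p1 : (1 <= p)%E).

Local Notation V := (LspaceType mu p1).
Local Notation F := (LfunType mu p1).
Local Notation Q := {mfun_ mu, T >-> measurableTypeR R}.

HB.instance Definition _ := gen_eqMixin V.
HB.instance Definition _ := gen_choiceMixin V.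

Lemma ae_eq_Lnorm (f g : T -> R) :
  measurable_fun [set: T] f -> measurable_fun [set: T] g -> f = g %[ae mu] ->
  'N[mu]_p[EFin \o f]%E = 'N[mu]_p[EFin \o g]%E.
Proof.
have mN (h : T -> R) (r : R) : measurable_fun [set: T] h ->
    measurable_fun [set: T] (fun x => `|h x| `^ r).
  move=> mh; apply: (measurableT_comp (measurable_powR _)) => //.
  exact: measurableT_comp.
move=> mf mg fg; rewrite unlock /Lnorm; case: p p1 => [r||//] _.
- congr (_ `^ _)%E; apply: ae_eq_integral => //=.
  + by apply/measurable_EFinP; exact: mN.
  + by apply/measurable_EFinP; exact: mN.
  + by apply: filterS fg => x /= h /h ->.
- by case: ifP => // _; apply: eq_ess_sup; apply: filterS fg => x /= /(_ I) ->.
Qed.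

Lemma repr_Lfun (x : V) : (x : T -> R) \in Lfun mu p.
Proof.
apply/andP; split; rewrite inE/=; last exact: Lebesgue_finite.
exact: (measurable_funPT (repr (x : Q))).
Qed.

Definition Lspace_repr (x : V) : F := Lfun_Sub p1 (repr_Lfun x).

Lemma Lspace_reprE (x : V) : Lspace_repr x = (x : T -> R) :> (T -> R).
Proof. by []. Qed.

Definition mfun_of_Lfun (f : F) : {mfun T >-> measurableTypeR R} :=
  HB.pack (f : T -> measurableTypeR R)
    (isMeasurableFun.Build _ _ T (measurableTypeR R) f (measurable_funPT f)).

Lemma repr_pi_ae (f : F) :
  (repr (\pi_Q (mfun_of_Lfun f)) : T -> R) = f %[ae mu].
Proof.
have /eqP := reprK (\pi_Q (mfun_of_Lfun f)).
by rewrite eqmodE => /asboolP.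
Qed.

Lemma Lnorm_pi (f : F) :
  'N[mu]_p[EFin \o (repr (\pi_Q (mfun_of_Lfun f)) : T -> R)]%E =
  'N[mu]_p[EFin \o f]%E.
Proof.
apply: ae_eq_Lnorm; last exact: repr_pi_ae; last exact: measurable_funPT.
exact: (measurable_funPT (repr (\pi_Q (mfun_of_Lfun f)))).
Qed.

Lemma finite_norm_pi (f : F) :
  finite_norm mu p (repr (\pi_Q (mfun_of_Lfun f)) : T -> R).
Proof. by rewrite /finite_norm Lnorm_pi; exact: Lfunction_finite. Qed.

Definition Lspace_pi (f : F) : V :=
  HB.pack (\pi_Q (mfun_of_Lfun f))
    (isFinLebesgue.Build _ _ _ mu p p1 (\pi_Q (mfun_of_Lfun f)) (finite_norm_pi f)).

Lemma Lspace_piK (f : F) : (Lspace_pi f : T -> R) = f %[ae mu].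
Proof. exact: repr_pi_ae. Qed.

Lemma LspaceP (x y : V) : (x : T -> R) = y %[ae mu] -> x = y.
Proof.
case: x => x [[hx]]; case: y => y [[hy]] /= xy.
have e : x = y.
  by rewrite -(reprK x) -(reprK y); apply/eqP; rewrite eqmodE; exact/asboolP.
by subst y; rewrite (Prop_irrelevance hx hy).
Qed.

Definition Lspace0 : V := Lspace_pi 0.
Definition Lspace_opp (x : V) : V := Lspace_pi (- Lspace_repr x).
Definition Lspace_add (x y : V) : V := Lspace_pi (Lspace_repr x + Lspace_repr y).
Definition Lspace_scale (a : R) (x : V) : V := Lspace_pi (a *: Lspace_repr x).
Definition Lspace_norm (x : V) : R := fine 'N[mu]_p[EFin \o (x : T -> R)].

Lemma Lspace0_ae : (Lspace0 : T -> R) = (fun=> 0) %[ae mu].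
Proof. exact: Lspace_piK. Qed.

Lemma Lspace_opp_ae x : (Lspace_opp x : T -> R) = (fun t => - x t) %[ae mu].
Proof. exact: Lspace_piK. Qed.

Lemma Lspace_add_ae x y :
  (Lspace_add x y : T -> R) = (fun t => x t + y t) %[ae mu].
Proof. exact: Lspace_piK. Qed.

Lemma Lspace_scale_ae a x :
  (Lspace_scale a x : T -> R) = (fun t => a * x t) %[ae mu].
Proof. exact: Lspace_piK. Qed.

Let addA : associative Lspace_add.
Proof.
move=> x y z; apply: LspaceP.
apply: filterS2
  (filterI (Lspace_add_ae x (Lspace_add y z)) (Lspace_add_ae y z))
  (filterI (Lspace_add_ae (Lspace_add x y) z) (Lspace_add_ae x y)).
by move=> t [/(_ I)-> /(_ I)->] [/(_ I)-> /(_ I)->] _; rewrite addrA.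
Qed.

Let addC : commutative Lspace_add.
Proof.
move=> x y; apply: LspaceP.
apply: filterS2 (Lspace_add_ae x y) (Lspace_add_ae y x).
by move=> t /(_ I)-> /(_ I)-> _; rewrite addrC.
Qed.

Let add0 : left_id Lspace0 Lspace_add.
Proof.
move=> x; apply: LspaceP; apply: filterS2 (Lspace_add_ae Lspace0 x) Lspace0_ae.
by move=> t /(_ I)-> /(_ I)-> _; rewrite add0r.
Qed.

Let addN : left_inverse Lspace0 Lspace_opp Lspace_add.
Proof.
move=> x; apply: LspaceP.
apply: filterS3 (Lspace_add_ae (Lspace_opp x) x) (Lspace_opp_ae x) Lspace0_ae.
by move=> t /(_ I)-> /(_ I)-> /(_ I)-> _; rewrite addNr.
Qed.

HB.instance Definition _ := GRing.isZmodule.Build V addA addC add0 addN.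

Let scaleA a b (x : V) :
  Lspace_scale a (Lspace_scale b x) = Lspace_scale (a * b) x.
Proof.
apply: LspaceP; apply: filterS3 (Lspace_scale_ae a (Lspace_scale b x))
  (Lspace_scale_ae b x) (Lspace_scale_ae (a * b) x).
by move=> t /(_ I)-> /(_ I)-> /(_ I)-> _; rewrite mulrA.
Qed.

Let scale1 : left_id 1 Lspace_scale.
Proof.
move=> x; apply: LspaceP; apply: filterS (Lspace_scale_ae 1 x).
by move=> t /(_ I)-> _; rewrite mul1r.
Qed.

Let scaleDr : right_distributive Lspace_scale +%R.
Proof.
move=> a x y; apply: LspaceP.
apply: filterS3 (filterI (Lspace_scale_ae a (x + y)) (Lspace_add_ae x y))
  (Lspace_add_ae (Lspace_scale a x) (Lspace_scale a y))
  (filterI (Lspace_scale_ae a x) (Lspace_scale_ae a y)).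
by move=> t [/(_ I)-> /(_ I)->] /(_ I)-> [/(_ I)-> /(_ I)->] _; rewrite mulrDr.
Qed.

Let scaleDl x : {morph Lspace_scale^~ x : a b / a + b}.
Proof.
move=> a b; apply: LspaceP.
apply: filterS2 (filterI (Lspace_scale_ae (a + b) x)
    (Lspace_add_ae (Lspace_scale a x) (Lspace_scale b x)))
  (filterI (Lspace_scale_ae a x) (Lspace_scale_ae b x)).
by move=> t [/(_ I)-> /(_ I)->] [/(_ I)-> /(_ I)->] _; rewrite mulrDl.
Qed.

HB.instance Definition _ :=
  GRing.Zmodule_isLmodule.Build R V scaleA scale1 scaleDr scaleDl.

Lemma Lspace_normE (x : V) :
  (Lspace_norm x)%:E = 'N[mu]_p[EFin \o (x : T -> R)]%E.
Proof. exact: (finite_norm_fine (Lspace_repr x)). Qed.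

Lemma Lspace_norm_pi (f : F) :
  (Lspace_norm (Lspace_pi f))%:E = 'N[mu]_p[EFin \o f]%E.
Proof. by rewrite Lspace_normE; exact: Lnorm_pi. Qed.

Let normD (x y : V) : Lspace_norm (x + y) <= Lspace_norm x + Lspace_norm y.
Proof.
by rewrite -lee_fin EFinD Lspace_norm_pi !Lspace_normE (eminkowski mu _ _ p1).
Qed.

Let normZ (a : R) (x : V) : Lspace_norm (a *: x) = `|a| * Lspace_norm x.
Proof.
apply: EFin_inj; rewrite EFinM Lspace_norm_pi Lspace_normE.
exact: (LnormZ (Lspace_repr x) a).
Qed.

Let norm0_eq0 (x : V) : Lspace_norm x = 0 -> x = 0.
Proof.
move=> /(@fine_Lnormr_eq0 _ _ _ _ _ p1 (Lspace_repr x)) x0; apply: LspaceP.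
apply: filterS2 x0 Lspace0_ae => t /= h1 h2 _.
by rewrite (h1 I) (h2 I).
Qed.

HB.instance Definition _ := Lmodule_isNormed.Build R V normD normZ norm0_eq0.

Lemma LspaceD_ae (x y : V) : ((x + y : V) : T -> R) = x \+ y %[ae mu].
Proof. exact: Lspace_add_ae. Qed.

Lemma LspaceB_ae (x y : V) :
  ((x - y : V) : T -> R) = (fun t => x t - y t) %[ae mu].
Proof.
apply: filterS2 (LspaceD_ae x (- y)) (Lspace_opp_ae y).
by move=> t /= h1 h2 _; rewrite (h1 I) /= (h2 I).
Qed.

Lemma Lspace_normrE (x : V) : `|x|%:E = 'N[mu]_p[EFin \o (x : T -> R)]%E.
Proof. exact: Lspace_normE. Qed.

End Lspace_normedModType.

Section restricted_measure.
Import HBNNSimple.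

Lemma ge0_integral_mrestr d (T : measurableType d) (R : realType)
    (mu : {measure set T -> \bar R}) (D : set T) (mD : measurable D)
    (f : T -> \bar R) :
  measurable_fun [set: T] f -> (forall t, 0 <= f t)%E ->
  (\int[mrestr mu mD]_x f x = \int[mu]_(x in D) f x)%E.
Proof.
move=> mf f0; pose g := nnsfun_approx measurableT mf.
transitivity (limn (fun n => \int[mrestr mu mD]_x (g n x)%:E))%E.
  rewrite -monotone_convergence//.
  - apply: eq_integral => y _; apply/esym/cvg_lim => //.
    by apply: cvg_nnsfun_approx.
  - by move=> n; exact/measurable_EFinP/measurable_funP.
  - by move=> n y _; rewrite lee_fin.
  - by move=> y _ m n mn; rewrite lee_fin; exact/lefP/nd_nnsfun_approx.
rewrite (_ : (fun n => _) = (fun n => \int[mu]_(x in D) (g n x)%:E)%E).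
  rewrite -monotone_convergence//.
  - by apply: eq_integral => y _; apply/cvg_lim => //; apply: cvg_nnsfun_approx.
  - move=> n; apply: measurable_funTS.
    exact/measurable_EFinP/measurable_funP.
  - by move=> n y _; rewrite lee_fin.
  - by move=> y _ m n mn; rewrite lee_fin; exact/lefP/nd_nnsfun_approx.
apply/funext => n.
have -> : (fun x => (g n x)%:E) = (fun x =>
    \sum_(k \in range (g n)) (k * \1_(g n @^-1` [set k]) x)%:E)%E.
  by apply/funext => x; rewrite fsumEFin// -fimfunE.
rewrite !ge0_integral_fsum//.
- apply: eq_fsbigr => r _.
  rewrite !integralZl_indic_nnsfun// !integral_indic//=.
  by rewrite /mrestr setIT.
- by move=> r; apply: measurable_funTS; exact/measurable_EFinP/measurable_funM.
- by move=> r x _; rewrite nnfun_muleindic_ge0.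
- by move=> r; exact/measurable_EFinP/measurable_funM.
- by move=> r x _; rewrite nnfun_muleindic_ge0.
Qed.

Lemma LspaceType2_mrestr_normE d (T : measurableType d) (R : realType)
    (mu : {measure set T -> \bar R}) (D : set T) (mD : measurable D)
    (x : LspaceType2 (mrestr mu mD)) :
  `|x|%:E = sqrte (\int[mu]_(s in D) ((x s) ^+ 2)%:E)%E.
Proof.
have mx : measurable_fun [set: T] (x : T -> R).
  exact: (measurable_funPT (Lspace_repr x)).
rewrite Lspace_normrE unlock /Lnorm.
rewrite poweR12_sqrt; last by apply: integral_ge0 => s _; rewrite poweR_ge0.
under eq_integral => s _ do
  rewrite poweR_EFin powR_mulrn ?normr_ge0// real_normK ?num_real//.
rewrite ge0_integral_mrestr//; last by move=> s; rewrite lee_fin sqr_ge0.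
by apply/measurable_EFinP; exact: measurable_funX.
Qed.

End restricted_measure.

Lemma caratheodory_measurable_itv (R : realType) (i : interval R) :
  (wlength (@idfun R))^*%mu.-cara.-measurable [set` i].
Proof. by apply: sub_caratheodory; exact: measurable_itv. Qed.

(* The sigma-algebra is that of all Lebesgue measurable sets of R, not only the
   Borel ones. *)
Definition L2_01 (R : realType) : Type :=
  LspaceType2 (mrestr (@completed_lebesgue_measure R)
                      (caratheodory_measurable_itv `[0, 1])).

Lemma L2_01_normE (R : realType) (x : L2_01 R) :
  `|x|%:E = sqrte (\int[@completed_lebesgue_measure R]_(s in `[0%R, 1%R])
                      ((x s) ^+ 2)%:E)%E.
Proof. exact: LspaceType2_mrestr_normE. Qed.

(* membership of g in L_2(D), i.e. of its extension by 0 in L_2(R) *)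
Definition in_L2 (R : realType) (D : set R) (g : R -> R) : Prop :=
  g \_ D \in Lfun (@completed_lebesgue_measure R) 2%:R%:E.

Definition sup_dist (R : realType) (K : R -> R -> R) (x : L2_01 R) : \bar R :=
  ereal_sup [set sqrte (\int[@completed_lebesgue_measure R]_(s in `[0%R, t])
                          ((K t s - x s) ^+ 2)%:E)%E | t in `[0, 1]].

(* Main.v *)
Require Import Defs.
From mathcomp Require Import all_boot all_order all_algebra.
From mathcomp Require Import all_classical all_reals all_analysis.
From mathcomp Require Import measurable_realfun.
Import Order.TTheory GRing.Theory Num.Theory.
Import numFieldNormedType.Exports.

Set Implicit Arguments.
Unset Strict Implicit.
Unset Printing Implicit Defensive.

Local Open Scope classical_set_scope.
Local Open Scope ring_scope.

(** Fix [t] and write [n_t] for the seminorm of square integration over [0, t],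
    so that [f x] is the supremum over [t] of [n_t (K t - x)]. Minkowski's
    inequality for [n_t], together with [n_t <= n_1], gives
    [n_t (K t - x) <= n_t (K t - y) + `|x - y|] for every [t]; the error term
    does not depend on [t], so it survives the supremum and [f] is 1-Lipschitz
    as an extended-real function ([sup_dist_lipschitz]). Splitting
    [K t - x] as [K t] minus [x] in the same way bounds [f x] by the supremum
    of [n_t (K t)] plus [`|x|], which is finite by hypothesis
    ([sup_dist_fin_num]). Being finite and 1-Lipschitz, [f] is continuous. *)

Section seminorm.
Context d (T : measurableType d) (R : realType).
Variables (mu : {measure set T -> \bar R}) (D : set T).
Hypothesis mD : measurable D.

(** Extension by zero turns the seminorm of square integration over [D] into
    the L_2 norm over the whole space, for which Minkowski's inequality holds. *)
Lemma Lnorm2_restrict (g : T -> R) :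
  'N[mu]_2%:E[EFin \o g \_ D]%E = sqrte (\int[mu]_(s in D) ((g s) ^+ 2)%:E)%E.
Proof.
rewrite unlock /Lnorm poweR12_sqrt; last first.
  by apply: integral_ge0 => s _; rewrite poweR_ge0.
rewrite [in RHS]integral_mkcond; congr (sqrte _).
apply: eq_integral => s _; rewrite poweR_EFin powR_mulrn ?normr_ge0//.
rewrite real_normK ?num_real// /= !patchE.
by case: ifP => // _; rewrite expr2 mul0r.
Qed.

(** Only the restrictions of [g] and [h] to [D] need be measurable, since the
    inequality is Minkowski's for their extensions by zero. *)
Lemma minkowski_on (g h : T -> R) :
  measurable_fun D g -> measurable_fun D h ->
  (sqrte (\int[mu]_(s in D) ((g s + h s) ^+ 2)%:E) <=
   sqrte (\int[mu]_(s in D) ((g s) ^+ 2)%:E) +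
   sqrte (\int[mu]_(s in D) ((h s) ^+ 2)%:E))%E.
Proof.
move=> mg mh.
have mr (k : T -> R) : measurable_fun D k -> measurable_fun [set: T] (k \_ D).
  by move=> mk; apply/(measurable_restrict _ mD measurableT); rewrite setTI.
rewrite -!Lnorm2_restrict.
have -> : (fun s => g s + h s) \_ D = g \_ D \+ h \_ D.
  by apply/funext => s /=; rewrite !patchE; case: ifP => // _; rewrite addr0.
by apply: eminkowski; [exact: mr|exact: mr|rewrite lee_fin ler1n].
Qed.

End seminorm.

Section distance_on.
Context d (T : measurableType d) (R : realType).
Variables (mu : {measure set T -> \bar R}) (D : set T) (mD : measurable D).
Implicit Types (A : set T) (x y : LspaceType2 (mrestr mu mD)).

Lemma measurable_Lspace x A : measurable_fun A (x : T -> R).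
Proof.
by apply: measurable_funTS; exact: (measurable_funPT (Lspace_repr x)).
Qed.

Lemma Lspace2_norm_on x A : measurable A -> A `<=` D ->
  (sqrte (\int[mu]_(s in A) ((x s) ^+ 2)%:E) <= `|x|%:E)%E.
Proof.
move=> mA AD; rewrite LspaceType2_mrestr_normE lee_sqrt; last first.
  by apply: integral_ge0 => s _; rewrite lee_fin sqr_ge0.
apply: ge0_subset_integral => //.
- by apply/measurable_EFinP; apply: measurable_funX; exact: measurable_Lspace.
- by move=> s _; rewrite lee_fin sqr_ge0.
Qed.

(** The representative of [x - y] differs from the difference of the
    representatives on a set that is null for the measure restricted to [D].
    The null set is dealt with by integrating over all of [D] with respect to
    that measure, before shrinking to [A]. *)
Lemma Lspace2_dist_on x y A : measurable A -> A `<=` D ->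
  (sqrte (\int[mu]_(s in A) ((x s - y s) ^+ 2)%:E) <= `|x - y|%:E)%E.
Proof.
move=> mA AD; rewrite LspaceType2_mrestr_normE.
have mB B : measurable_fun B (fun s => ((x s - y s) ^+ 2)%:E).
  apply/measurable_EFinP; apply: measurable_funX.
  by apply: measurable_funB; exact: measurable_Lspace.
have mxy B : measurable_fun B (fun s => (((x - y : LspaceType2 _) s) ^+ 2)%:E).
  by apply/measurable_EFinP; apply: measurable_funX; exact: measurable_Lspace.
have -> : (\int[mu]_(s in D) (((x - y : LspaceType2 _) s) ^+ 2)%:E =
           \int[mu]_(s in D) ((x s - y s) ^+ 2)%:E)%E.
  rewrite -!(ge0_integral_mrestr _ mD)//; try by
    move=> s; rewrite lee_fin sqr_ge0.
  apply: ae_eq_integral => //.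
  by apply: filterS (LspaceB_ae x y) => s /= /(_ I) -> _.
rewrite lee_sqrt; last by apply: integral_ge0 => s _; rewrite lee_fin sqr_ge0.
by apply: ge0_subset_integral => // s _; rewrite lee_fin sqr_ge0.
Qed.

(** The error term is the full norm of [x - y], independent of [A]: this is
    what makes the bound uniform over the intervals [0, t]. *)
Lemma dist_on_lipschitz (k : T -> R) x y A :
  measurable A -> A `<=` D -> measurable_fun A k ->
  (sqrte (\int[mu]_(s in A) ((k s - x s) ^+ 2)%:E) <=
   sqrte (\int[mu]_(s in A) ((k s - y s) ^+ 2)%:E) + `|x - y|%:E)%E.
Proof.
move=> mA AD mk; rewrite distrC.
have -> : (fun s => ((k s - x s) ^+ 2)%:E) =
          (fun s => ((k s - y s + (y s - x s)) ^+ 2)%:E).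
  by apply/funext => s; rewrite addrA subrK.
apply: le_trans (leeD2l _ (Lspace2_dist_on y x mA AD)).
by apply: minkowski_on => //; apply: measurable_funB => //;
  exact: measurable_Lspace.
Qed.

Lemma dist_on_le_norm (k : T -> R) x A :
  measurable A -> A `<=` D -> measurable_fun A k ->
  (sqrte (\int[mu]_(s in A) ((k s - x s) ^+ 2)%:E) <=
   sqrte (\int[mu]_(s in A) ((k s) ^+ 2)%:E) + `|x|%:E)%E.
Proof.
move=> mA AD mk.
apply: le_trans (leeD2l _ (Lspace2_norm_on x mA AD)).
under [X in (_ <= _ + sqrte X)%E]eq_integral do rewrite -sqrrN.
apply: minkowski_on => //.
by apply: measurableT_comp => //; exact: measurable_Lspace.
Qed.

Lemma Lfun_restrict_measurable (p : \bar R) (g : T -> R) :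
  g \_ D \in Lfun mu p -> measurable_fun D g.
Proof.
move=> /andP[]; rewrite inE /= => mg _.
by move/(measurable_restrict _ mD measurableT): mg; rewrite setTI.
Qed.

End distance_on.

Section sup_dist.
Context (R : realType) (K : R -> R -> R).
Hypothesis K_L2 : forall t, t \in `[0, 1] -> in_L2 `[0, t] (K t).
Implicit Types x y : L2_01 R.
Local Notation mu := (@completed_lebesgue_measure R).

Let mI (t : R) := caratheodory_measurable_itv `[0, t].

Let subI (t : R) : t \in `[0, 1] -> `[0, t]%classic `<=` `[0, 1]%classic.
Proof.
by rewrite in_itv => /andP[_ t1]; apply: subset_itvl; rewrite bnd_simp.
Qed.

Lemma sup_dist_ge0 x : (0 <= sup_dist K x)%E.
Proof.
apply: (le_trans (sqrte_ge0 _)); apply: ereal_sup_ubound.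
by exists 0 => //=; rewrite in_itv/= lexx ler01.
Qed.

Lemma sup_dist_lipschitz x y :
  (sup_dist K x <= sup_dist K y + `|x - y|%:E)%E.
Proof.
apply: ge_ereal_sup => _ [t t01 <-].
have mK := Lfun_restrict_measurable (mI t) (K_L2 t01).
apply: le_trans (dist_on_lipschitz x y (mI t) (subI t01) mK) _.
by rewrite leeD2r//; apply: ereal_sup_ubound; exists t.
Qed.

Lemma sup_dist_fin_num x :
  (ereal_sup [set \int[mu]_(s in `[0%R, t])
                    ((K t s) ^+ 2)%:E | t in `[0%R, 1%R]] < +oo)%E ->
  sup_dist K x \is a fin_num.
Proof.
set M := ereal_sup _ => M_fin; rewrite ge0_fin_numE ?sup_dist_ge0//.
have leM t : t \in `[0, 1] ->
    (\int[mu]_(s in `[0%R, t]) ((K t s) ^+ 2)%:E <= M)%E.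
  by move=> t01; apply: ereal_sup_ubound; exists t.
have M0 : (0 <= M)%E.
  apply: le_trans (leM 0 _); last by rewrite /= in_itv/= lexx ler01.
  by apply: integral_ge0 => s _; rewrite lee_fin sqr_ge0.
apply: (@le_lt_trans _ _ (sqrte M + `|x|%:E)%E).
  apply: ge_ereal_sup => _ [t t01 <-].
  have mK := Lfun_restrict_measurable (mI t) (K_L2 t01).
  apply: le_trans (dist_on_le_norm x (mI t) (subI t01) mK) _.
  by rewrite leeD2r// lee_sqrt// leM.
rewrite lte_add_pinfty ?ltry//.
by rewrite -ge0_fin_numE ?sqrte_ge0// sqrte_fin_num// ge0_fin_numE.
Qed.

End sup_dist.

Theorem corollary1 (R : realType) (K : R -> R -> R)
    (K_L2 : forall t, t \in `[0, 1] -> in_L2 `[0, t] (K t))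
    (K_bounded :
      (ereal_sup [set \int[@completed_lebesgue_measure R]_(s in `[0%R, t])
                        ((K t s) ^+ 2)%:E | t in `[0%R, 1%R]] < +oo)%E) :
  (forall x : L2_01 R, sup_dist K x \is a fin_num) /\
  continuous (fun x : L2_01 R => fine (sup_dist K x)).
Proof.
have fin x : sup_dist K x \is a fin_num by exact: sup_dist_fin_num.
split=> // x.
have lip a b : fine (sup_dist K a) - fine (sup_dist K b) <= `|a - b|.
  rewrite lerBlDl -lee_fin EFinD (fineK (fin a)) (fineK (fin b)).
  exact: sup_dist_lipschitz.
apply: (iffRL (@cvgrPdist_le _ _ _ _ (nbhs_filter x) _ _)) => e e0.
have : \forall y \near x, `|x - y| < e.
  by exact: (@cvgr_dist_lt _ _ _ _ (nbhs_filter x) id x).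
apply: filterS => y xy; apply: le_trans (ltW xy).
by rewrite ler_norml lip lerNl opprB distrC lip.
Qed.
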